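(* Let $f(x)=x^4+a_2x^2+a_1x+a_0$ with real coefficients such that $a_1\neq 0$ and $a_2<0$. Then Algorithm A (described in the context) is well-defined for $f$ and it yields the global minimizer of $f$. That is, with $t_0=\sqrt{-a_2/2}$ and $x_0=-\sqrt[3]{a_1/4}$, the initial value problem $$\dot x(t)=-\frac{4\,t\,x(t)}{6\,x^2(t)+2\,t^2+a_2}\quad\text{for a.e. } t\in[0,t_0],\qquad x(t_0)=x_0,$$ has a unique solution $x(\cdot)$ on $[0,t_0]$, and $x(0)$ is the global minimizer of $f$.
   Context: Cube roots are real cube roots. Algorithm A, for a polynomial $f(x)=x^4+a_2x^2+a_1x+a_0$, is: Step 1: let $t_0=\sqrt{-a_2/2}$ and $x_0=-\sqrt[3]{a_1/4}$. Step 2: solve the initial value problem $\dot x(t)=-\frac{4tx(t)}{6x^2(t)+2t^2+a_2}$ for a.e. $t\in[0,t_0]$, $x(t_0)=x_0$. Step 3: report $x(0)$ as the global minimizer of $f$. The algorithm is said to be well-defined for $f$ if its steps can be carried out; this entails in particular that the solution of the initial value problem in Step 2 exists on $[0,t_0]$ and is obtained uniquely. A solution is understood as an absolutely continuous function satisfying the equation (with nonzero denominator) for a.e. $t$ and the condition at $t_0$. *)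

(* Defs.v *)
From HB Require Import structures.
From mathcomp Require Import all_boot all_order all_algebra.
From mathcomp Require Import all_classical all_reals all_analysis.

Set Implicit Arguments.
Unset Strict Implicit.
Unset Printing Implicit Defensive.

Import Order.TTheory GRing.Theory Num.Theory.
Import numFieldNormedType.Exports.

Local Open Scope classical_set_scope.
Local Open Scope ring_scope.

Definition cbrt (R : realType) (y : R) : R := Num.sg y * `|y| `^ (3%:R^-1).

Lemma cbrtK (R : realType) (y : R) : cbrt y ^+ 3 = y.
Proof.
rewrite /cbrt exprMn -[X in _ * X]powR_mulrn ?powR_ge0 // -powRrM.
rewrite mulVf ?pnatr_eq0 // powRr1 // exprS sqr_sg.
have [->|y0] := eqVneq y 0; first by rewrite normr0 mulr0.
by rewrite mulr1 -numEsg.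
Qed.

Definition absolutely_continuous (R : realType) (a b : R) (f : R -> R) : Prop :=
  forall e : R, 0 < e -> exists2 d : R, 0 < d &
    forall (n : nat) (u v : 'I_n -> R),
      (forall i, [/\ a <= u i, u i <= v i & v i <= b]) ->
      trivIset setT (fun i => `]u i, v i[%classic) ->
      \sum_i (v i - u i) < d ->
      \sum_i `|f (v i) - f (u i)| < e.

Definition is_global_minimizer (R : realType) (f : R -> R) (m : R) : Prop :=
  forall y : R, f m <= f y.

Definition is_unique_global_minimizer (R : realType) (f : R -> R) (m : R) : Prop :=
  is_global_minimizer f m /\
  forall m' : R, is_global_minimizer f m' -> m' = m.

Definition quartic (R : realType) (a2 a1 a0 : R) : {poly R} :=
  'X^4 + a2 *: 'X^2 + a1 *: 'X + a0%:P.

Definition algA_t0 (R : realType) (a2 : R) : R := Num.sqrt (- a2 / 2%:R).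

Definition algA_x0 (R : realType) (a1 : R) : R := - cbrt (a1 / 4%:R).

Definition algA_den (R : realType) (a2 t x : R) : R :=
  6%:R * x ^+ 2 + 2%:R * t ^+ 2 + a2.

(* Only the restriction of [x] to [[0, t0]] matters: the derivative below is
   two-sided, but the endpoints are Lebesgue-negligible. The denominator is
   required to be nonzero because [z / 0 = 0] in a MathComp field. *)
Definition algA_solution (R : realType) (a2 a1 : R) (x : R -> R) : Prop :=
  [/\ absolutely_continuous 0 (algA_t0 a2) x,
      {ae (@lebesgue_measure R), forall t : R, t \in `[0, algA_t0 a2] ->
         algA_den a2 t (x t) != 0 /\
         is_derive t 1 x (- (4%:R * t * x t / algA_den a2 t (x t)))} &
      x (algA_t0 a2) = algA_x0 a1].

(* The condition [0 <= - a2 / 2] is what makes [t0] a genuine real square root: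
   [Num.sqrt] is [0] on negative arguments. *)
Definition algA_well_defined (R : realType) (a2 a1 : R) : Prop :=
  0 <= - a2 / 2%:R /\
  exists x : R -> R, algA_solution a2 a1 x /\
    forall y : R -> R, algA_solution a2 a1 y ->
      forall t : R, t \in `[0, algA_t0 a2] -> y t = x t.

Definition algA_reports (R : realType) (a2 a1 m : R) : Prop :=
  exists2 x : R -> R, algA_solution a2 a1 x & m = x 0.

(* Main.v *)
Require Import Defs.
From mathcomp Require Import all_boot all_order all_algebra.
From mathcomp Require Import all_classical all_reals all_analysis.
From mathcomp Require Import ring lra.

Set Implicit Arguments.
Unset Strict Implicit.
Unset Printing Implicit Defensive.

Import Order.TTheory GRing.Theory Num.Theory.
Import numFieldNormedType.Exports.

Local Open Scope ring_scope.

(** The differential equation is an exact one: it says that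
    [G t x = 4 x^3 + (2 a2 + 4 t^2) x + a1] keeps a constant value along
    [x(t)]. Here [G t] is the derivative of [f(x) + 2 t^2 x^2], a convexified
    quartic which is convex at [t = t0] and equals [f] at [t = 0], and [x0] is
    the critical point of the convexified quartic at [t0], where
    [2 a2 + 4 t0^2] vanishes. So a solution follows a critical point from the
    convex problem back to [f], and three questions remain.

    Which critical point?  For every [t] the cubic [G t] has exactly one root
    whose sign is opposite to that of [a1] (predicate [branch]). At such a
    root, [x (4 x^2 + 2 a2 + 4 t^2) = - a1] makes the bracket positive; from
    this single inequality follow uniqueness of the root, nonvanishing of the
    denominator, and, through the secant form of the equation
    ([branch_secant]), that the root depends on [t] in a Lipschitz and
    differentiable way with the prescribed derivative ([branch_is_derive],
    [branch_absolutely_continuous]). This gives existence.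

    Why is there no other solution?  For a solution [y], [G t (y t)] is
    absolutely continuous with derivative zero almost everywhere, hence
    constant ([absolutely_continuous_derive0_cst]), and it vanishes at [t0]. As
    [G t 0 = a1] is nonzero, the continuous [y] cannot vanish, so it keeps the
    sign of [x0] and stays on the branch ([solution_branch]).

    Why is [m = x(0)] the global minimizer?  Since [m] is critical for [f],
    [f y - f m = (y - m)^2 ((y + m)^2 + 2 m^2 + a2)], and [2 m^2 + a2] is half
    the positive bracket above ([branch_global_minimizer]). *)

(** * Absolutely continuous functions *)

Lemma absolutely_continuousS (R : realType) (a b c d : R) (f : R -> R) :
  a <= c -> d <= b -> absolutely_continuous a b f -> absolutely_continuous c d f.
Proof.
move=> ac db fac e e0; have [r r0 H] := fac e e0; exists r => // n u v uv.
by apply: H => i; have [? ? ?] := uv i; split=> //; lra.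
Qed.

(** The common source of the stability properties: the increments of [h] are
    controlled, interval by interval, by those of [f] and [g]. *)
Lemma absolutely_continuous_dominated (R : realType) (a b M : R)
    (f g h : R -> R) : 0 < M ->
  (forall u v, a <= u -> u <= v -> v <= b ->
     `|h v - h u| <= M * (`|f v - f u| + `|g v - g u|)) ->
  absolutely_continuous a b f -> absolutely_continuous a b g ->
  absolutely_continuous a b h.
Proof.
move=> M0 dom fac gac e e0.
have e'0 : 0 < e / (2 * M) by rewrite divr_gt0 // mulr_gt0.
have [d1 d10 H1] := fac _ e'0; have [d2 d20 H2] := gac _ e'0.
exists (Num.min d1 d2) => [|n u v uv tI]; first by rewrite lt_min d10.
rewrite lt_min => /andP[/(H1 n u v uv tI) {}H1 /(H2 n u v uv tI) {}H2].
apply: (@le_lt_trans _ _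
    (\sum_(i < n) M * (`|f (v i) - f (u i)| + `|g (v i) - g (u i)|))).
  by apply: ler_sum => i _; have [? ? ?] := uv i; exact: dom.
rewrite -mulr_sumr big_split /=.
apply: (@lt_le_trans _ _ (M * (e / (2 * M) + e / (2 * M)))).
  by rewrite ltr_pM2l // ltrD.
by rewrite le_eqVlt; apply/orP; left; apply/eqP; field; rewrite gt_eqF.
Qed.

Lemma absolutely_continuous_id (R : realType) (a b : R) :
  absolutely_continuous a b id.
Proof.
move=> e e0; exists e => // n u v uv _; apply: le_lt_trans.
by apply: ler_sum => i _; have [_ uv' _] := uv i; rewrite ger0_norm ?subr_ge0.
Qed.

Lemma absolutely_continuous_lipschitz (R : realType) (a b L : R) (f : R -> R) :
  (forall u v, a <= u -> u <= v -> v <= b -> `|f v - f u| <= L * (v - u)) ->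
  absolutely_continuous a b f.
Proof.
move=> Lf; have M0 : 0 < `|L| + 1 by rewrite ltr_wpDl.
apply: (@absolutely_continuous_dominated _ _ _ _ id id _ M0); last 2 first.
- exact: absolutely_continuous_id.
- exact: absolutely_continuous_id.
move=> u v au uv vb; apply: le_trans (Lf _ _ au uv vb) _.
rewrite (@ger0_norm _ (v - u)) ?subr_ge0 //.
have := ler_norm L; nra.
Qed.

(** Uniform continuity, by testing absolute continuity on one interval. *)
Lemma absolutely_continuous_modulus (R : realType) (a b e : R) (f : R -> R) :
  absolutely_continuous a b f -> 0 < e ->
  exists2 d, 0 < d & forall u v, a <= u <= b -> a <= v <= b -> `|v - u| < d ->
    `|f v - f u| < e.
Proof.
move=> fac e0; have [d d0 H] := fac e e0; exists d => //.
have key u v : a <= u -> u <= v -> v <= b -> v - u < d -> `|f v - f u| < e.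
  move=> au uv vb duv.
  have := H 1%N (fun=> u) (fun=> v); rewrite !big_ord1; apply=> //.
  by move=> i j _ _ _; rewrite !ord1.
move=> u v /andP[au ub] /andP[av vb]; have [uv|/ltW vu] := leP u v.
  by rewrite ger0_norm ?subr_ge0 //; exact: key.
by rewrite distrC [X in X < e]distrC ger0_norm ?subr_ge0 //; exact: key.
Qed.

Lemma absolutely_continuous_continuous (R : realType) (a b : R) (f : R -> R) :
  absolutely_continuous a b f -> ({within `[a, b], continuous f})%classic.
Proof.
move=> fac; apply/subspace_continuousP => x /=; rewrite in_itv /= => abx.
apply/cvgrPdist_lt => e e0.
have [d d0 H] := absolutely_continuous_modulus fac e0.
rewrite near_withinE; exists d => //= t /= tx; rewrite in_itv /= => abt.
by apply: H; rewrite // distrC in tx *.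
Qed.

Lemma absolutely_continuous_bounded (R : realType) (a b : R) (f : R -> R) :
  absolutely_continuous a b f ->
  exists2 B, 0 < B & forall t, a <= t <= b -> `|f t| <= B.
Proof.
move=> /absolutely_continuous_continuous fc.
have /compact_bounded [M [_ HM]] := continuous_compact fc (@segment_compact _ a b).
exists (`|M| + 1) => [|t abt]; first by rewrite ltr_wpDl.
apply: (HM (`|M| + 1)); first by rewrite (le_lt_trans (ler_norm _)) // ltrDl.
by exists t => //=; rewrite in_itv.
Qed.

Lemma absolutely_continuousD (R : realType) (a b : R) (f g : R -> R) :
  absolutely_continuous a b f -> absolutely_continuous a b g ->
  absolutely_continuous a b (f \+ g).
Proof.
apply: (absolutely_continuous_dominated ltr01) => u v _ _ _ /=.
by rewrite mul1r opprD addrACA ler_normD.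
Qed.

(** Boundedness of both factors turns the product rule for increments into a
    domination. *)
Lemma absolutely_continuousM (R : realType) (a b : R) (f g : R -> R) :
  absolutely_continuous a b f -> absolutely_continuous a b g ->
  absolutely_continuous a b (f \* g).
Proof.
move=> fac gac.
have [A A0 fA] := absolutely_continuous_bounded fac.
have [B B0 gB] := absolutely_continuous_bounded gac.
apply: (absolutely_continuous_dominated (addr_gt0 A0 B0)) fac gac.
move=> u v au uv vb /=.
have -> : f v * g v - f u * g u = (f v - f u) * g v + f u * (g v - g u) by ring.
apply: le_trans (ler_normD _ _) _; rewrite !normrM.
have gv : `|g v| <= B by apply: gB; rewrite (le_trans au uv).
have fu : `|f u| <= A by apply: fA; rewrite au (le_trans uv vb).
have := normr_ge0 (f v - f u); have := normr_ge0 (g v - g u).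
have := normr_ge0 (g v); have := normr_ge0 (f u).
nra.
Qed.

Lemma absolutely_continuous_cst (R : realType) (a b k : R) :
  absolutely_continuous a b (fun=> k).
Proof.
apply: (@absolutely_continuous_lipschitz _ _ _ 0) => u v _ _ _.
by rewrite subrr normr0 mul0r.
Qed.

(** * A null derivative forces constancy *)

(** Continuous induction: the step at the supremum of the points reached so far
    starts at or just below it and, unless it is [b], ends above it. The
    two-sided step from [s <= c] to [s' >= c] is what gauge-type arguments
    supply, so the lemma stands in for the existence of a partition subordinate
    to a gauge (Cousin's lemma). *)
Lemma interval_induction (R : realType) (P : R -> Prop) (a b : R) :
  a <= b -> P a ->
  (forall c, a <= c <= b -> exists2 d, 0 < d & forall s s',
     a <= s <= c -> c <= s' <= b -> c - d < s -> s' < c + d -> P s -> P s') ->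
  P b.
Proof.
move=> ab Pa step.
pose S : set R := [set s | a <= s <= b /\ P s]%classic.
have Sa : S a by split; rewrite ?lexx ?ab.
have supS : has_sup S by split; [exists a | exists b => s [/andP[]]].
have acb : a <= sup S <= b.
  apply/andP; split; first exact: (ub_le_sup supS.2).
  by apply: ge_sup; [exists a | move=> s [/andP[]]].
have [d d0 H] := step _ acb.
have [s [/andP[as_ sb] Ps] ds] := sup_adherent d0 supS.
have sc : s <= sup S by apply: (ub_le_sup supS.2); split; rewrite ?as_ ?sb.
have [bd|db] := ltP b (sup S + d).
  by apply: H Ps => //; rewrite ?as_ ?sc ?lexx ?andbT //; case/andP: acb.
have Pd : P (sup S + d / 2).
  by apply: H Ps => //; lra.
have : sup S + d / 2 <= sup S.
  by apply: (ub_le_sup supS.2); split => //; lra.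
lra.
Qed.

Lemma is_derive0_small (R : realType) (f : R -> R) (c e : R) :
  is_derive c 1 f 0 -> 0 < e ->
  exists2 d, 0 < d & forall s, `|s - c| < d -> `|f s - f c| <= e * `|s - c|.
Proof.
move=> /is_derive1_caratheodory [g [fg gc g0]] e0.
have /cvgrPdist_lt /(_ e e0) [d /= d0 H] := gc.
exists d => // s sc; rewrite fg normrM ler_wpM2r //.
by have := H s; rewrite /= g0 sub0r normrN distrC => /(_ sc)/ltW.
Qed.

Lemma null_set_open_cover (R : realType) (N : set R) (e : R) :
  (@lebesgue_measure R).-negligible N -> 0 < e ->
  exists U : set R, [/\ open U, (N `<=` U)%classic & (lebesgue_measure U < e%:E)%E].
Proof.
move=> [A [mA A0 NA]] e0.
have [|U [oU AU UAe]] := lebesgue_regularity_outer mA _ e0;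
  first by rewrite [X in (X < _)%E]A0.
exists U; split=> //; first exact: subset_trans AU.
rewrite -(setDKU AU) measureU0 //.
by apply: measurableD => //; exact: measurable_realfun.open_measurable.
Qed.

Lemma disjoint_itv_sum_le (R : realType) (U : set R) (n : nat) (u v : 'I_n -> R) :
  measurable U -> (forall i, u i <= v i) ->
  (forall i, `]u i, v i[ `<=` U)%classic ->
  trivIset setT (fun i => `]u i, v i[%classic) ->
  ((\sum_i (v i - u i))%:E <= lebesgue_measure U)%E.
Proof.
move=> mU uv uvU tI.
rewrite -sumEFin; under eq_bigr => i _.
  rewrite (_ : (v i - u i)%:E = lebesgue_measure `]u i, v i[%classic); last first.
    rewrite lebesgue_measure_itv /= lte_fin; case: ltP => // vu.
    by rewrite (le_anti (_ : u i <= v i <= u i)) ?uv ?vu // subrr.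
  over.
rewrite -measure_semi_additive_ord //; last exact: bigsetU_measurable.
apply: le_measure; rewrite ?inE //; first exact: bigsetU_measurable.
by rewrite -bigcup_seq; apply: bigcup_sub => i _.
Qed.

(** Pointwise almost everywhere information is not enough for constancy (the
    Cantor function); absolute continuity pays for the exceptional null set.
    Cover that set by an open [U] of small measure and walk from [a] to [c] by
    continuous induction. Around a good point the increment is at most [k] times
    the length of the step; around an exceptional point the step is an interval
    inside [U], which is recorded. The recorded intervals are disjoint and lie in
    [U], so their total length is small and absolute continuity bounds the sum
    of their increments. *)
Lemma absolutely_continuous_derive0_cst (R : realType) (a b : R) (f : R -> R) :
  absolutely_continuous a b f ->
  {ae (@lebesgue_measure R), forall t, a <= t <= b -> is_derive t 1 f 0} ->
  forall t, a <= t <= b -> f t = f a.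
Proof.
move=> fac0 fae c /andP[ac cb].
pose N := (~` [set t | a <= t <= b -> is_derive t 1 f 0])%classic.
have N0 : (@lebesgue_measure R).-negligible N := fae.
have fac := absolutely_continuousS (lexx a) cb fac0.
apply/eqP; rewrite -subr_eq0 -normr_eq0 eq_le normr_ge0 andbT.
apply/ler_addgt0Pl => e e0; rewrite addr0.
(* The slope [k] spends at most [e / 2] on the whole of [[a, c]]; adding [1]
   keeps the denominator positive when [c = a]. *)
have k0 : 0 < e / (2 * (c - a + 1)) by rewrite divr_gt0 // mulr_gt0 //; lra.
set k := e / _ in k0.
have [d d0 fd] := fac (e / 2) (divr_gt0 e0 (ltr0n _ 2)).
have [U [oU NU Ud]] := null_set_open_cover N0 d0.
(* The invariant at [s]: [n] intervals recorded from left to right. They are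
   indexed by [nat] so that recording one more only changes the value at [n]. *)
pose P s := exists n (u v : nat -> R),
  [/\ forall i, (i < n)%N -> [/\ a <= u i, u i <= v i & v i <= s],
      forall i j, (i < j < n)%N -> v i <= u j,
      forall i, (i < n)%N -> (`]u i, v i[ `<=` U)%classic &
      `|f s - f a| <= k * (s - a) + \sum_(i < n) `|f (v i) - f (u i)|].
have [n [u [v [uv uvI uvU fca]]]] : P c.
  apply: (interval_induction ac).
    exists 0%N, (fun=> a), (fun=> a); split => //.
    by rewrite big_ord0 !subrr normr0 mulr0 addr0.
  move=> x /andP[ax xc].
  have [Nx|/contrapT dfx] := pselect (N x).
    (* An exceptional point: record the step [(s, s')], which lies in [U]. *)
    have [r /= r0 rU] := open_nbhs_nbhs (conj oU (NU _ Nx)).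
    exists r => // s s' /andP[as_ sx] /andP[xs' s'c] rs s'r.
    move=> [n [u [v [uv uvI uvU fs]]]].
    exists n.+1, (fun i => if i == n then s else u i),
      (fun i => if i == n then s' else v i); split.
    - move=> i; rewrite ltnS leq_eqVlt; case: (eqVneq _ n) => /= [_ _|_ /uv[? ? ?]].
        by split=> //; lra.
      by split=> //; lra.
    - move=> i j /andP[ij]; rewrite ltnS leq_eqVlt.
      case: (eqVneq _ n) => /= [jn _|_ jn].
        by rewrite jn in ij; rewrite (ltn_eqF ij); have [] := uv _ ij.
      by rewrite (ltn_eqF (ltn_trans ij jn)) uvI // ij.
    - move=> i; rewrite ltnS leq_eqVlt; case: (eqVneq _ n) => /= [_ _|_ /uvU //].
      move=> z /=; rewrite in_itv /= => /andP[sz zs']; apply: rU.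
      by rewrite /ball /= ltr_norml; apply/andP; split; lra.
    - rewrite big_ord_recr /= eqxx.
      under eq_bigr => i _ do rewrite (ltn_eqF (ltn_ord i)).
      rewrite (_ : f s' - f a = (f s - f a) + (f s' - f s)); last by ring.
      apply: le_trans (ler_normD _ _) _; rewrite addrA lerD2r.
      by apply: le_trans fs _; rewrite lerD2r ler_pM2l //; lra.
  (* A good point: the same intervals serve, and since [s <= x <= s'] the two
     increments from [x] add up to at most [k * (s' - s)]. *)
  have axb : a <= x <= b by rewrite ax (le_trans xc).
  have [r r0 H] := is_derive0_small (dfx axb) k0.
  exists r => // s s' /andP[as_ sx] /andP[xs' s'c] rs s'r.
  move=> [n [u [v [uv uvI uvU fs]]]]; exists n, u, v; split => //.
    by move=> i /uv[? ? ?]; split=> //; lra.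
  have Hs : `|f s - f x| <= k * (x - s).
    by have := H s; rewrite (distrC s) (@ger0_norm _ (x - s)) ?subr_ge0 //;
      apply; lra.
  have Hs' : `|f s' - f x| <= k * (s' - x).
    by have := H s'; rewrite (@ger0_norm _ (s' - x)) ?subr_ge0 //; apply; lra.
  rewrite (_ : f s' - f a = (f s - f a) + (f s' - f x) - (f s - f x));
    last by ring.
  apply: le_trans (ler_normB _ _) _.
  have := ler_normD (f s - f a) (f s' - f x); lra.
apply: (le_trans fca).
have tI : trivIset setT (fun i : 'I_n => `]u i, v i[%classic).
  suff H i j : (i < j < n)%N -> (`]u i, v i[ `&` `]u j, v j[ = set0)%classic.
    apply/trivIsetP => i j _ _ ij; case: (ltngtP i j) => [ltij|ltji|/val_inj eij].
    - by apply: H; rewrite ltij ltn_ord.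
    - by rewrite setIC; apply: H; rewrite ltji ltn_ord.
    - by rewrite eij eqxx in ij.
  move=> /uvI vu; rewrite -subset0 => z /= []; rewrite !in_itv /=; lra.
have : \sum_(i < n) `|f (v i) - f (u i)| < e / 2.
  apply: (fd n (fun i => u i) (fun i => v i) (fun i => uv _ (ltn_ord i)) tI).
  rewrite -lte_fin; apply: le_lt_trans Ud; apply: disjoint_itv_sum_le => //.
  - exact: measurable_realfun.open_measurable.
  - by move=> i; have [] := uv _ (ltn_ord i).
  - by move=> i; exact: uvU.
suff : k * (c - a) <= e / 2 by lra.
have -> : e / 2 = k * (c - a + 1) by rewrite /k; field; lra.
rewrite ler_pM2l //; lra.
Qed.

(** * The branch of critical points *)

(** The derivative in [x] of the convexified quartic
    [x^4 + a2 x^2 + a1 x + a0 + 2 t^2 x^2]. *)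
Definition homotopy_slope (R : realType) (a2 a1 t x : R) : R :=
  4 * x ^+ 3 + (2 * a2 + 4 * t ^+ 2) * x + a1.

(** The sign condition selects one of the possibly three roots of the cubic: the
    side on which the linear term [a1 x] is negative is where the quartic has its
    global minimum. Stating it as [a1 * x < 0] treats both signs of [a1] at once
    and excludes [x = 0]. *)
Definition branch (R : realType) (a2 a1 t x : R) : Prop :=
  homotopy_slope a2 a1 t x = 0 /\ a1 * x < 0.

Lemma branch_neq0 (R : realType) (a2 a1 t x : R) :
  branch a2 a1 t x -> x != 0.
Proof. by move=> [_]; apply: contraTneq => ->; rewrite mulr0 ltxx. Qed.

(** The equation reads [x * (4 x^2 + 2 a2 + 4 t^2) = - a1]; multiplied by [x], its
    right-hand side is positive. *)
Lemma branch_coef_gt0 (R : realType) (a2 a1 t x : R) :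
  branch a2 a1 t x -> 0 < 4 * x ^+ 2 + 2 * a2 + 4 * t ^+ 2.
Proof.
move=> bx; have x0 := branch_neq0 bx; have [Gx a1x] := bx.
have x2 : 0 < x ^+ 2 by rewrite exprn_even_gt0.
rewrite -(pmulr_rgt0 _ x2).
suff -> : x ^+ 2 * (4 * x ^+ 2 + 2 * a2 + 4 * t ^+ 2) = - (a1 * x) by lra.
rewrite /homotopy_slope in Gx.
transitivity (x * (4 * x ^+ 3 + (2 * a2 + 4 * t ^+ 2) * x + a1) - a1 * x).
  by ring.
by rewrite Gx mulr0 sub0r.
Qed.

(** The divided difference in [x] of [homotopy_slope] at fixed [t], that is, the
    slope of its chord between [x] and [y]. *)
Definition secant (R : realType) (a2 t x y : R) : R :=
  4 * (x ^+ 2 + x * y + y ^+ 2) + 2 * a2 + 4 * t ^+ 2.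

(** The difference of the two equations, factored: the move of the root in
    terms of the move of the parameter. *)
Lemma branch_secant (R : realType) (a2 a1 s t x y : R) :
  branch a2 a1 t x -> branch a2 a1 s y ->
  (x - y) * secant a2 t x y = - (4 * (t ^+ 2 - s ^+ 2) * y).
Proof.
move=> [Gx _] [Gy _]; apply/eqP; rewrite -subr_eq0 opprK; apply/eqP.
transitivity (homotopy_slope a2 a1 t x - homotopy_slope a2 a1 s y).
  by rewrite /homotopy_slope /secant; ring.
by rewrite Gx Gy subrr.
Qed.

(** The bracket of [branch_coef_gt0] is positive, and so is [x * y] because
    both roots have the sign of [- a1]. *)
Lemma branch_secant_gt (R : realType) (a2 a1 s t x y : R) :
  branch a2 a1 t x -> branch a2 a1 s y ->
  4 * y ^+ 2 < secant a2 t x y.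
Proof.
move=> bx by_; have Kx := branch_coef_gt0 bx.
have xy : 0 < x * y.
  have := bx.2; have := by_.2; nra.
by rewrite /secant; lra.
Qed.

(** One estimate for uniqueness of the root ([s = t]), continuity of the branch,
    and its Lipschitz bound. The factor [`|y|] stays on the left since it is only
    bounded below locally in [t]. *)
Lemma branch_dist (R : realType) (a2 a1 s t x y : R) :
  branch a2 a1 t x -> branch a2 a1 s y ->
  `|x - y| * `|y| <= `|t ^+ 2 - s ^+ 2|.
Proof.
move=> bx by_; have K := branch_secant_gt bx by_.
have y0 : 0 < `|y| by rewrite normr_gt0; exact: branch_neq0 by_.
have K0 : 0 < secant a2 t x y by apply: le_lt_trans K; rewrite mulr_ge0 ?sqr_ge0.
have /(congr1 Num.norm) := branch_secant bx by_.
rewrite normrN !normrM (gtr0_norm K0) (gtr0_norm (_ : 0 < 4)) // => E.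
rewrite -(ler_pM2r y0) -(ler_pM2l (ltr0n _ 4)) [leRHS]mulrA -E.
rewrite -real_normK ?num_real // in K.
have := normr_ge0 (x - y); nra.
Qed.

Lemma branch_unique (R : realType) (a2 a1 t x y : R) :
  branch a2 a1 t x -> branch a2 a1 t y -> x = y.
Proof.
move=> bx by_; have := branch_dist bx by_.
rewrite subrr normr0 -normrM normr_le0 mulf_eq0 subr_eq0.
by rewrite (negPf (branch_neq0 by_)) orbF => /eqP.
Qed.

Lemma branch_exists (R : realType) (a2 a1 t : R) :
  a1 != 0 -> exists x, branch a2 a1 t x.
Proof.
(* The substitution [x = - a1 * z] turns the equation, divided by [- a1], into
   [A z^3 + p z - 1 = 0] with [A > 0] and the sign condition into [z > 0]. *)
move=> a10; set p := 2 * a2 + 4 * t ^+ 2; pose A := 4 * a1 ^+ 2.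
have A0 : 0 < A by rewrite /A mulr_gt0 // exprn_even_gt0.
pose h : {poly R} := A *: 'X^3 + p *: 'X - 1.
have hE z : h.[z] = A * z ^+ 3 + p * z - 1.
  by rewrite /h !hornerE.
(* Chosen so that [1 <= M] and [`|p| + 1 <= A * M]: then [A M^2 + p >= 1]. *)
pose M := 1 + (`|p| + 1) / A.
have AM : A * M = A + `|p| + 1 by rewrite /M; field; rewrite gt_eqF.
have M1 : 1 <= M by rewrite lerDl divr_ge0 ?addr_ge0 // ltW.
have [|z /andP[z0 _] /rootP] := @poly_ivt _ h 0 M (le_trans ler01 M1).
  rewrite !hE expr0n mulr0 mulr0 addr0 sub0r lerN10 /=.
  have pM : - p <= `|p| by rewrite -normrN ler_norm.
  have -> : A * M ^+ 3 = (A * M) * M ^+ 2 by ring.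
  rewrite AM; have := normr_ge0 p; nra.
rewrite hE => hz.
exists (- a1 * z); split.
  rewrite /homotopy_slope -/p.
  transitivity (- a1 * (A * z ^+ 3 + p * z - 1)); first by rewrite /A; ring.
  by rewrite hz mulr0.
have {}z0 : 0 < z.
  rewrite lt_def z0 andbT; apply: contra_eq_neq hz => ->.
  by rewrite expr0n /= !mulr0; lra.
rewrite mulrA mulrN mulNr oppr_lt0 mulr_gt0 // -expr2 exprn_even_gt0 //.
Qed.

(** At [t0] the linear coefficient vanishes and the equation is a pure cube. *)
Lemma branch_t0 (R : realType) (a2 a1 : R) :
  a1 != 0 -> a2 < 0 -> branch a2 a1 (algA_t0 a2) (algA_x0 a1).
Proof.
move=> a10 a20.
have t2 : algA_t0 a2 ^+ 2 = - a2 / 2 by rewrite sqr_sqrtr //; lra.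
have x3 : algA_x0 a1 ^+ 3 = - (a1 / 4).
  by rewrite /algA_x0 -[in RHS](@cbrtK R (a1 / 4)); ring.
have a1E : a1 = - 4 * algA_x0 a1 ^+ 3 by rewrite x3; field.
split; first by rewrite /homotopy_slope t2 x3; field.
have x0 : algA_x0 a1 != 0.
  by apply: contra_neq a10 => x0; rewrite a1E x0; ring.
rewrite [X in X * _]a1E -mulrA -exprSr mulNr oppr_lt0 mulr_gt0 //.
by rewrite exprn_even_gt0.
Qed.

(** When the linear coefficient is nonpositive, [4 |x|^3 >= |a1|]. If moreover
    [|x| < 1] then [|x|^3 <= |x|], whence the bound. *)
Lemma branch_lower_bound (R : realType) (a2 a1 t x : R) :
  2 * a2 + 4 * t ^+ 2 <= 0 -> branch a2 a1 t x ->
  Num.min 1 (`|a1| / 4) <= `|x|.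
Proof.
move=> p0 bx; have x0 := branch_neq0 bx; have [Gx a1x] := bx.
have a1E : `|a1| * `|x| <= 4 * `|x| ^+ 3 * `|x|.
  rewrite -normrM ltr0_norm // -mulrA -exprSr -normrX ger0_norm ?exprn_even_ge0 //.
  have -> : - (a1 * x) = 4 * x ^+ 4 + (2 * a2 + 4 * t ^+ 2) * x ^+ 2
     - x * homotopy_slope a2 a1 t x by rewrite /homotopy_slope; ring.
  by rewrite Gx mulr0 subr0 gerDl; have := sqr_ge0 x; nra.
rewrite ler_pM2r ?normr_gt0 // in a1E.
rewrite ge_min; have [//|/ltW x1 /=] := leP 1 `|x|.
have := normr_ge0 x; nra.
Qed.

(** Dividing [branch_secant] by the chord slope displays the difference quotient
    of [x] as an expression continuous at [t]. Implicit differentiation is thus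
    replaced by Caratheodory's criterion. *)
Lemma branch_is_derive (R : realType) (a2 a1 : R) (x : R -> R) (t : R) :
  (forall s, branch a2 a1 s (x s)) ->
  is_derive t 1 x (- (4 * t * x t / algA_den a2 t (x t))).
Proof.
move=> bx; apply/is_derive1_caratheodory.
have K0 s : 0 < secant a2 s (x s) (x t).
  by apply: le_lt_trans (branch_secant_gt (bx s) (bx t));
    rewrite mulr_ge0 ?sqr_ge0.
have xt : 0 < `|x t| by rewrite normr_gt0; exact: branch_neq0 (bx t).
have xc : {for t, continuous x}.
  apply/cvgrPdist_le => e e0.
  have : \forall s \near t, `|s ^+ 2 - t ^+ 2| < e * `|x t|.
    have /cvgrPdist_lt := @exprn_continuous R 2 t.
    move=> /(_ _ (mulr_gt0 e0 xt)); apply: filterS => s; by rewrite distrC.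
  apply: filterS => s /ltW H; rewrite distrC -(ler_pM2r xt).
  by apply: le_trans H; exact: branch_dist.
exists (fun s => - (4 * (s + t) * x t / secant a2 s (x s) (x t))); split.
- move=> s; have := branch_secant (bx s) (bx t) => E.
  apply: (mulIf (lt0r_neq0 (K0 s))); rewrite E; field; exact: lt0r_neq0.
- apply: cvgN; apply: cvgM; last (apply: cvgV; [exact: lt0r_neq0|]);
    rewrite /secant ?expr2;
    by do ?[apply: cvgD|apply: cvgM|exact: cvg_cst|exact: cvg_id|exact: xc].
- have := K0 t; rewrite /secant /algA_den => K; field.
  apply/andP; split; first lra.
  lra.
Qed.

(** * The value at time zero *)

Lemma horner_quartic (R : realType) (a2 a1 a0 y : R) :
  (quartic a2 a1 a0).[y] = y ^+ 4 + a2 * y ^+ 2 + a1 * y + a0.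
Proof. by rewrite /quartic !(hornerD, hornerZ, hornerXn, hornerX, hornerC). Qed.

(** Eliminating [a1] with [f' m = 0] leaves
    [f y - f m = (y - m)^2 * ((y + m)^2 + (2 m^2 + a2))], and the last summand is
    half the positive bracket of [branch_coef_gt0] at [t = 0]. *)
Lemma branch_global_minimizer (R : realType) (a2 a1 a0 m : R) :
  branch a2 a1 0 m ->
  is_unique_global_minimizer (fun y : R => (quartic a2 a1 a0).[y]) m.
Proof.
move=> bm; have K := branch_coef_gt0 bm; have [Gm _] := bm.
have gap y : (quartic a2 a1 a0).[y] - (quartic a2 a1 a0).[m] =
    (y - m) ^+ 2 * ((y + m) ^+ 2 + (2 * m ^+ 2 + a2)).
  rewrite !horner_quartic.
  have -> : a1 = - (4 * m ^+ 3 + 2 * a2 * m)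
    by move: Gm; rewrite /homotopy_slope; lra.
  ring.
have c0 : 0 < 2 * m ^+ 2 + a2 by lra.
split=> [y|y ymin].
  by rewrite -subr_ge0 gap mulr_ge0 ?sqr_ge0 // addr_ge0 ?sqr_ge0 // ltW.
apply/eqP; rewrite -subr_eq0 -sqrf_eq0 eq_le sqr_ge0 andbT.
have := ymin m; rewrite -subr_le0 gap pmulr_lle0 //.
by rewrite ltr_wpDl ?sqr_ge0.
Qed.

(** * Solutions of the initial value problem *)

Lemma algA_t0_coef_le0 (R : realType) (a2 t : R) :
  a2 < 0 -> 0 <= t <= algA_t0 a2 -> 2 * a2 + 4 * t ^+ 2 <= 0.
Proof.
move=> a20 /andP[t0 tt0].
have t02 : algA_t0 a2 ^+ 2 = - a2 / 2 by rewrite sqr_sqrtr //; lra.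
have : t ^+ 2 <= algA_t0 a2 ^+ 2 by rewrite lerXn2r // nnegrE // (le_trans t0).
by rewrite t02; lra.
Qed.

(** A Lipschitz bound: in [branch_dist], [|t^2 - s^2| <= 2 t0 |t - s|], and the
    root stays away from zero on [[0, t0]] by [branch_lower_bound]. *)
Lemma branch_absolutely_continuous (R : realType) (a2 a1 : R) (x : R -> R) :
  a1 != 0 -> a2 < 0 -> (forall s, branch a2 a1 s (x s)) ->
  absolutely_continuous 0 (algA_t0 a2) x.
Proof.
move=> a10 a20 bx; set T := algA_t0 a2; pose c : R := Num.min 1 (`|a1| / 4).
have c0 : 0 < c by rewrite lt_min ltr01 divr_gt0 // normr_gt0.
apply: (@absolutely_continuous_lipschitz _ _ _ (2 * T / c)) => u v u0 uv vT.
have cx : c <= `|x u|.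
  apply: branch_lower_bound (bx u); apply: algA_t0_coef_le0 => //.
  by rewrite u0 (le_trans uv).
have : `|x v - x u| * `|x u| <= (2 * T) * (v - u).
  apply: le_trans (branch_dist (bx v) (bx u)) _.
  by rewrite subr_sqr mulrC ger0_norm ?mulr_ge0 ?ler_wpM2r; lra.
move=> H; rewrite mulrAC ler_pdivlMr //; apply: le_trans H.
by rewrite ler_wpM2l.
Qed.

Lemma branch_solution (R : realType) (a2 a1 : R) (x : R -> R) :
  a1 != 0 -> a2 < 0 -> (forall s, branch a2 a1 s (x s)) ->
  algA_solution a2 a1 x.
Proof.
move=> a10 a20 bx; split.
- exact: (branch_absolutely_continuous a10 a20 bx).
- apply: aeW => t _; split; last exact: branch_is_derive.
  have := branch_coef_gt0 (bx t); have := sqr_ge0 (x t).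
  by rewrite /algA_den => ? ?; rewrite gt_eqF //; lra.
- by apply: (branch_unique (bx _)); exact: branch_t0.
Qed.

(** A pointwise algebraic form, to which the rules for sums and products of
    absolutely continuous and of differentiable functions apply directly. *)
Lemma homotopy_slope_along (R : realType) (a2 a1 : R) (y : R -> R) :
  (fun t => homotopy_slope a2 a1 t (y t)) =
  cst 4 * (y * y * y) + (cst (2 * a2) + cst 4 * (id * id)) * y + cst a1.
Proof. by apply/funext => t; rewrite /homotopy_slope !fctE; ring. Qed.

(** The differential equation is exactly the vanishing of this derivative. *)
Lemma homotopy_slope_is_derive (R : realType) (a2 a1 t dy : R) (y : R -> R) :
  is_derive t 1 y dy ->
  is_derive t 1 (fun s => homotopy_slope a2 a1 s (y s))
    (2 * (algA_den a2 t (y t) * dy + 4 * t * y t)).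
Proof.
move=> yd; rewrite homotopy_slope_along; apply: is_derive_eq.
by rewrite !fctE /GRing.scale /= /algA_den; ring.
Qed.

Lemma solution_slope0 (R : realType) (a2 a1 : R) (y : R -> R) :
  a1 != 0 -> a2 < 0 -> algA_solution a2 a1 y ->
  forall t, 0 <= t <= algA_t0 a2 -> homotopy_slope a2 a1 t (y t) = 0.
Proof.
move=> a10 a20 [yac yae yt0].
pose g t := homotopy_slope a2 a1 t (y t).
have gac : absolutely_continuous 0 (algA_t0 a2) g.
  rewrite /g homotopy_slope_along.
  by do ?[apply: absolutely_continuousD|apply: absolutely_continuousM
    |exact: absolutely_continuous_cst|exact: absolutely_continuous_id|exact: yac].
have gae : {ae (@lebesgue_measure R),
    forall t, 0 <= t <= algA_t0 a2 -> is_derive t 1 g 0}.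
  apply: (@filterS _ _ (ae_filter_ringOfSetsType _) _ _ _ yae) => t yt t01.
  have [|den0 dy] := yt; first by rewrite in_itv.
  have := homotopy_slope_is_derive a2 a1 dy.
  rewrite -/g => dg; apply: (is_derive_eq dg).
  by rewrite mulrN mulrCA divff // mulr1 addNr mulr0.
have gcst := absolutely_continuous_derive0_cst gac gae.
move=> t t01; rewrite -/(g t) gcst // -(gcst (algA_t0 a2)).
  by rewrite /g yt0; have [] := branch_t0 a10 a20.
by rewrite sqrtr_ge0 lexx.
Qed.

(** The sign condition propagates from [t0] down to [t]: were it to fail at [t],
    the intermediate value theorem would give a zero of [y], but the cubic takes
    the value [a1], not [0], at [x = 0]. *)
Lemma solution_branch (R : realType) (a2 a1 : R) (y : R -> R) :
  a1 != 0 -> a2 < 0 -> algA_solution a2 a1 y ->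
  forall t, 0 <= t <= algA_t0 a2 -> branch a2 a1 t (y t).
Proof.
move=> a10 a20 ysol t /andP[t0 tT]; split.
  by apply: solution_slope0 => //; rewrite t0.
have [yac _ yT] := ysol.
have zac : absolutely_continuous t (algA_t0 a2) ((fun=> a1) \* y).
  apply: absolutely_continuousM; first exact: absolutely_continuous_cst.
  exact: absolutely_continuousS yac.
have [_ a1x0] := branch_t0 a10 a20; rewrite -yT in a1x0.
rewrite ltNge; apply/negP => a1y.
have [|c] := IVT (v := 0) tT (absolutely_continuous_continuous zac).
  by rewrite /= ge_min le_max a1y (ltW a1x0) orbT.
rewrite in_itv /= => /andP[tc cT] /eqP; rewrite mulf_eq0 (negPf a10) /= => /eqP yc.
have := @solution_slope0 _ _ _ _ a10 a20 ysol c.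
rewrite (le_trans t0 tc) cT => /(_ isT).
rewrite /homotopy_slope yc expr0n /= !mulr0 !add0r => a1E.
by rewrite a1E eqxx in a10.
Qed.

Theorem theorem3 (R : realType) (a2 a1 a0 : R) (ha1 : a1 != 0) (ha2 : a2 < 0) :
  algA_well_defined a2 a1 /\
  exists2 m : R, algA_reports a2 a1 m &
    is_unique_global_minimizer (fun y : R => (quartic a2 a1 a0).[y]) m.
Proof.
have [x bx] := choice (fun s => branch_exists a2 s ha1).
have xsol := branch_solution ha1 ha2 bx.
split; last by exists (x 0); [exists x | exact: branch_global_minimizer].
split; first lra.
exists x; split=> // y ysol t; rewrite in_itv /= => tT.
exact: branch_unique (solution_branch ha1 ha2 ysol tT) (bx t).
Qed.
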